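(* Let $\Gamma_{\mathrm{DTE}}=(R,A,U)$ be the game in which the players are the robots $R=\{r_1,\dots,r_n\}$, the action set of robot $r_i$ is a minimal action set $A_i\subseteq\mathbf{P}_i$ (as defined in the context), $A=A_1\times\cdots\times A_n$, and the utilities are $U_i(\mathbf{p})=\sum_{\tau_j\in\tau}\left[v_j(\mathbf{c}_j(\mathbf{p}))-v_j(\mathbf{c}_j(\mathbf{p}_{-i}))\right]$. Let $f(\mathbf{p})=\sum_{\tau_j\in\tau}v_j(\mathbf{c}_j(\mathbf{p}))$. If all robots follow log-linear learning (LLL) with noise parameter $\epsilon>0$ in a repeated play of $\Gamma_{\mathrm{DTE}}$, generating the random action profiles $\mathbf{p}(0),\mathbf{p}(1),\dots$ from an arbitrary $\mathbf{p}(0)\in A$, then $$\lim_{\epsilon\to0^+}\ \lim_{k\to\infty}\ \Pr\left[f(\mathbf{p}(k))=\max_{\mathbf{q}\in\mathbf{P}}f(\mathbf{q})\right]=1.$$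
   Context: **Environment and trajectories.** $P=\{1,\dots,\bar x\}\times\{1,\dots,\bar y\}$ with $\bar x,\bar y\in\mathbb{Z}_+$ is a grid, $P_F\subseteq P$ is the set of feasible cells, and $S\subseteq P_F$ is the set of station cells. For $p=(x,y)\in P_F$, $N(p)=\{(x',y')\in P_F: |x'-x|\le 1,\ |y'-y|\le 1\}$. There are $n$ robots $R=\{r_1,\dots,r_n\}$; robot $r_i$ is assigned a station $\sigma_i\in S$ (several robots may share a station). With $T\in\mathbb{Z}_+$ the episode length, the set of feasible trajectories of $r_i$ is $\mathbf{P}_i=\{\mathbf{p}_i=(p_i^0,\dots,p_i^T): p_i^0=p_i^T=\sigma_i,\ p_i^{t+1}\in N(p_i^t)\ \forall t<T\}$, and $\mathbf{P}=\mathbf{P}_1\times\cdots\times\mathbf{P}_n$. **Tasks.** $\tau=\{\tau_1,\dots,\tau_m\}$ is a finite set of tasks, $\tau_j=(\ell_j,t^a_j,t^d_j,v_j)$, with location $\ell_j\in P_F$, arrival and departure times $t^a_j<t^d_j$ in $\{0,\dots,T\}$, and value function $v_j$. Tasks at the same location have non-overlapping windows: if $i\ne j$ and $\ell_i=\ell_j$ then $\min\{t^d_i,t^d_j\}\le\max\{t^a_i,t^a_j\}$. For $\mathbf{p}\in\mathbf{P}$, $c_j(\mathbf{p},t)=|\{r_k\in R: p_k^t=p_k^{t+1}=\ell_j\}|$ and $\mathbf{c}_j(\mathbf{p})=[c_j(\mathbf{p},t^a_j),\dots,c_j(\mathbf{p},t^d_j-1)]^{\mathsf T}$. The vector $\mathbf{c}_j(\mathbf{p}_{-i})$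 is defined in the same way but counting only robots in $R\setminus\{r_i\}$. The function $v_j$ maps such count vectors to $[0,\bar v_j]$, where $\bar v_j>0$ is the maximum value of the task, and is monotone: $\mathbf{c}\ge\mathbf{c}'$ entrywise implies $v_j(\mathbf{c})\ge v_j(\mathbf{c}')$. **Minimal action sets.** For $\mathbf{q}_i\in\mathbf{P}_i$ let $t^*(\mathbf{q}_i,\tau)=\{t: \exists\,\tau_j\in\tau,\ q_i^t=q_i^{t+1}=\ell_j,\ t^a_j\le t<t^d_j\}$. The action set $A_i$ is a minimum-cardinality set among all nonempty $A_i'\subseteq\mathbf{P}_i$ satisfying: for every $\mathbf{q}_i\in\mathbf{P}_i\setminus A_i'$ there is $\mathbf{p}_i\in A_i'$ such that $p_i^t=p_i^{t+1}=q_i^t$ for all $t\in t^*(\mathbf{q}_i,\tau)$. **Log-linear learning (LLL).** Fix $\epsilon>0$ and start from an arbitrary $\mathbf{p}(0)\in A$. At each round $k=0,1,2,\dots$, pick a robot $r_i\in R$ uniformly at random (independently of the past). Its next action is drawn from $A_i$ with probabilities proportional to exponentiated utilities: $$\Pr[\mathbf{p}_i(k+1)=\mathbf{p}_i]=\frac{\exp\left(U_i(\mathbf{p}_i,\mathbf{p}_{-i}(k))/\epsilon\right)}{\sum_{\mathbf{p}_i'\in A_i}\exp\left(U_i(\mathbf{p}_i',\mathbf{p}_{-i}(k))/\epsilon\right)},\qquad \mathbf{p}_i\in A_i.$$ All other robots keep their actions: $\mathbf{p}_{-i}(k+1)=\mathbf{p}_{-i}(k)$. *)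

(* Defs.v *)
From HB Require Import structures.
From mathcomp Require Import all_boot all_order all_algebra.
From mathcomp Require Import all_classical all_reals all_analysis.

Set Implicit Arguments.
Unset Strict Implicit.
Unset Printing Implicit Defensive.

Import Order.TTheory GRing.Theory Num.Theory.
Import numFieldNormedType.Exports.

Local Open Scope classical_set_scope.
Local Open Scope ring_scope.

(* Ordinals start at 0, so the cell (x, y) of the grid is (x - 1, y - 1) here;
   only coordinate differences are ever used. *)
Definition cell (xbar ybar : nat) : finType := ('I_xbar * 'I_ybar)%type.

Definition neighbors xbar ybar (PF : {set cell xbar ybar})
    (c : cell xbar ybar) : {set cell xbar ybar} :=
  [set c' in PF | (`|(c'.1 : nat)%:Z - (c.1 : nat)%:Z| <= 1) &&
                  (`|(c'.2 : nat)%:Z - (c.2 : nat)%:Z| <= 1)]%SET.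

(* Times are natural numbers, and the position of p at time t is p (inord t);
   every time used below is at most T, so inord never truncates. *)
Definition trajectory (xbar ybar T : nat) : finType :=
  {ffun 'I_T.+1 -> cell xbar ybar}.

Definition profile (xbar ybar T n : nat) : finType :=
  {ffun 'I_n -> trajectory xbar ybar T}.

Definition feasible xbar ybar T (PF : {set cell xbar ybar})
    (station : cell xbar ybar) : {set trajectory xbar ybar T} :=
  [set p : trajectory xbar ybar T |
     [&& p (inord 0) == station, p (inord T) == station &
         [forall t : 'I_T, p (inord t.+1) \in neighbors PF (p (inord t))]]]%SET.

Definition feasible_profiles xbar ybar T n (PF : {set cell xbar ybar})
    (sigma : 'I_n -> cell xbar ybar) : {set profile xbar ybar T n} :=
  [set p : profile xbar ybar T n |
     [forall i, p i \in feasible T PF (sigma i)]]%SET.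

Definition stays_at xbar ybar T (p : trajectory xbar ybar T) (t : nat)
    (c : cell xbar ybar) : bool :=
  (p (inord t) == c) && (p (inord t.+1) == c).

Record task (R : realType) (xbar ybar n : nat) := Task {
  location : cell xbar ybar;
  arrival : nat;
  departure : nat;
  max_value : R;
  (* entry s of a count vector is the count at time arrival + s *)
  value : {ffun 'I_(departure - arrival) -> 'I_n.+1} -> R
}.

(* The bound max_value is not required to be attained by value: it may need
   more robots than are available. *)
Record valid_task (R : realType) xbar ybar n (T : nat)
    (PF : {set cell xbar ybar}) (tk : task R xbar ybar n) : Prop := ValidTask {
  location_feasible : location tk \in PF;
  arrival_departure : (arrival tk < departure tk)%N;
  departure_le : (departure tk <= T)%N;
  max_value_gt0 : 0 < max_value tk;
  value_ge0 : forall c, 0 <= value (t := tk) c;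
  value_le_max : forall c, value (t := tk) c <= max_value tk;
  value_monotone : forall c c' : {ffun 'I_(departure tk - arrival tk) -> 'I_n.+1},
    (forall s, (c' s <= c s)%N) -> value c' <= value c
}.

Definition non_overlapping (R : realType) xbar ybar n m
    (tau : 'I_m -> task R xbar ybar n) : Prop :=
  forall i j, i != j -> location (tau i) = location (tau j) ->
    (minn (departure (tau i)) (departure (tau j)) <=
     maxn (arrival (tau i)) (arrival (tau j)))%N.

Section Game.
Variables (R : realType) (xbar ybar T n m : nat).
Variables (PF : {set cell xbar ybar}) (tau : 'I_m -> task R xbar ybar n).

Local Notation trajectory := (trajectory xbar ybar T).
Local Notation profile := (profile xbar ybar T n).

Lemma count_subproof (Q : pred 'I_n) : (#|Q| < n.+1)%N.
Proof. by rewrite ltnS -[leqRHS]card_ord max_card. Qed.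

(* Counts only the robots in Q: all of them for c_j(p), all but i for
   c_j(p_{-i}). *)
Definition robot_count (Q : pred 'I_n) (p : profile) (t : nat)
    (c : cell xbar ybar) : 'I_n.+1 :=
  Ordinal (count_subproof [pred k | Q k && stays_at (p k) t c]).

Definition counts (Q : pred 'I_n) (p : profile) (j : 'I_m) :
    {ffun 'I_(departure (tau j) - arrival (tau j)) -> 'I_n.+1} :=
  [ffun s : 'I_(departure (tau j) - arrival (tau j)) =>
     robot_count Q p (arrival (tau j) + s) (location (tau j))].

Definition total_value (p : profile) : R :=
  \sum_(j < m) value (counts predT p j).

Definition utility (i : 'I_n) (p : profile) : R :=
  \sum_(j < m) (value (counts predT p j) - value (counts (predC1 i) p j)).

Definition task_times (q : trajectory) : {set 'I_T} :=
  [set t : 'I_T | [exists j : 'I_m,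
     stays_at q t (location (tau j)) &&
     (arrival (tau j) <= t < departure (tau j))%N]]%SET.

Definition covering (station : cell xbar ybar) (A : {set trajectory}) : Prop :=
  [/\ A != finset.set0,
      A \subset feasible T PF station &
      forall q, q \in feasible T PF station -> q \notin A ->
        exists2 p, p \in A &
          forall t : 'I_T, t \in task_times q -> stays_at p t (q (inord t))].

Definition minimal_action_set (station : cell xbar ybar)
    (A : {set trajectory}) : Prop :=
  covering station A /\ forall B, covering station B -> (#|A| <= #|B|)%N.

Definition update (p : profile) (i : 'I_n) (a : trajectory) : profile :=
  [ffun k => if k == i then a else p k].

Variable A : 'I_n -> {set trajectory}.

Definition lll_prob (eps : R) (i : 'I_n) (p : profile) (a : trajectory) : R :=
  expR (utility i (update p i a) / eps) /
  \sum_(a' in A i) expR (utility i (update p i a') / eps).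

Section Process.
Variables (d : measure_display) (Omega : measurableType d).
Variable (Pr : probability Omega R).
(* X k is the profile p(k) and r k the robot picked at round k. *)
Variables (X : nat -> Omega -> profile) (r : nat -> Omega -> 'I_n).

Definition past (k : nat) (x : nat -> profile) (i : nat -> 'I_n) : set Omega :=
  [set w | (forall l, (l <= k)%N -> X l w = x l) /\
           (forall l, (l < k)%N -> r l w = i l)].

(* Conditional probabilities given the past are written in product form. Since
   lll_prob sums to 1 over A j, revision also says that, almost surely, all
   robots other than j keep their actions. *)
Record log_linear_learning (eps : R) (p0 : profile) : Prop := LLL {
  measurable_profile : forall k x, measurable [set w | X k w = x];
  measurable_pick : forall k i, measurable [set w | r k w = i];
  initial_profile : Pr [set w | X 0%N w = p0] = 1%E;
  uniform_pick : forall k x i j,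
    Pr (past k x i `&` [set w | r k w = j]) =
    (Pr (past k x i) * (n%:R^-1)%:E)%E;
  revision : forall k x i j a, a \in A j ->
    Pr (past k x i `&` [set w | r k w = j] `&`
        [set w | X k.+1 w = update (x k) j a]) =
    (Pr (past k x i `&` [set w | r k w = j]) * (lll_prob eps j (x k) a)%:E)%E
}.

End Process.
End Game.

(* The base value 0 of the iterated maximum is harmless: total_value is
   nonnegative and there is always a feasible profile. *)
Definition max_total_value (R : realType) xbar ybar T n m
    (PF : {set cell xbar ybar}) (sigma : 'I_n -> cell xbar ybar)
    (tau : 'I_m -> task R xbar ybar n) : R :=
  \big[Num.max/0]_(q in feasible_profiles T PF sigma) total_value tau q.

(* Main.v *)
(** The utility of robot i is f minus a term that does not depend on the action
    of i, so log-linear learning is heat-bath (Glauber) dynamics for f: it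
    satisfies detailed balance with respect to the Gibbs measure proportional to
    exp(f / eps) on A. Revising the robots 0, ..., n-1 in turn leads from any
    profile to any element of A, so the n-step kernel is minorized by a positive
    multiple of the Gibbs measure (Doeblin's condition) and the law of p(k)
    converges geometrically to that measure. A profile with f < max f has Gibbs
    mass at most exp(-(max f - f) / eps) <= eps / (max f - f), which vanishes
    with eps. Finally, the maximum over A is the maximum over all feasible
    profiles, because replacing a trajectory by one covering it does not
    decrease any count and the values are monotone. *)

Require Import Defs.
From HB Require Import structures.
From mathcomp Require Import all_boot all_order all_algebra.
From mathcomp Require Import all_classical all_reals all_analysis.
From mathcomp Require Import ring.

Set Implicit Arguments.
Unset Strict Implicit.
Unset Printing Implicit Defensive.

Import Order.TTheory GRing.Theory Num.Theory.
Import numFieldNormedType.Exports.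

Local Open Scope classical_set_scope.
Local Open Scope ring_scope.

(** * Geometric convergence of a finite chain under Doeblin's condition *)

Section FiniteChain.
Variables (R : realType) (I : finType) (K : I -> I -> R).

(** Measures are arbitrary functions, neither normalized nor signed a priori, so that a remainder
    such as [nu - c * pi] can be pushed as well. *)
Definition push (nu : I -> R) (y : I) : R := \sum_x nu x * K x y.

Lemma iter_push_ge0 (nu : I -> R) (k : nat) :
  (forall x y, 0 <= K x y) -> (forall x, 0 <= nu x) ->
  forall x, 0 <= iter k push nu x.
Proof.
move=> K_ge0 nu_ge0; elim: k => [|k IHk] x //=.
by apply: sumr_ge0 => y _; apply: mulr_ge0.
Qed.

Lemma iter_push_invariant (pi : I -> R) (k : nat) :
  push pi = pi -> iter k push pi = pi.
Proof. by move=> pi_inv; elim: k => //= k ->. Qed.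

Lemma iter_pushB (nu pi : I -> R) (c : R) (k : nat) (x : I) :
  iter k push (fun y => nu y - c * pi y) x =
  iter k push nu x - c * iter k push pi x.
Proof.
elim: k x => //= k IHk x; rewrite /push mulr_sumr -sumrB.
by apply: eq_bigr => y _; rewrite IHk mulrBl mulrA.
Qed.

Variables (pi : I -> R) (delta : R) (N : nat) (mu : nat -> I -> R).
Hypotheses (K_ge0 : forall x y, 0 <= K x y) (pi_inv : push pi = pi)
  (pi_ge0 : forall x, 0 <= pi x) (pi_sum : \sum_x pi x = 1).
Hypotheses (N_gt0 : (0 < N)%N) (delta_gt0 : 0 < delta) (delta_le1 : delta <= 1).
Hypothesis minorization : forall nu : I -> R, (forall x, 0 <= nu x) ->
  forall z, delta * (\sum_x nu x) * pi z <= iter N push nu z.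
Hypotheses (mu_ge0 : forall x, 0 <= mu 0%N x)
  (mu_sum : forall k, \sum_x mu k x = 1)
  (muS : forall k, mu k.+1 = push (mu k)).

Let muD (k l : nat) : mu (l + k) = iter l push (mu k).
Proof. by elim: l => //= l <-; rewrite addSn muS. Qed.

(** The remainder [mu k - c * pi] is a nonnegative measure of mass [1 - c]. By minorization, [N]
    steps turn at least [delta * (1 - c)] of it into a multiple of [pi], while invariance preserves
    the share [c] already gained. *)
Lemma chain_lower_bound_step (k : nat) (c : R) :
  (forall x, c * pi x <= mu k x) ->
  forall x, (1 - (1 - c) * (1 - delta)) * pi x <= mu (N + k)%N x.
Proof.
move=> le_mu x; have := minorization (nu := fun x => mu k x - c * pi x).
move=> /(_ _ x).
rewrite (iter_pushB (mu k)) (iter_push_invariant _ pi_inv) -muD.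
rewrite sumrB -mulr_sumr mu_sum pi_sum mulr1 lerBrDr => le_muN.
apply: le_trans (le_muN _); last by move=> y; rewrite subr_ge0.
by rewrite -mulrDl ler_wpM2r // le_eqVlt; apply/orP; left; apply/eqP; ring.
Qed.

Lemma chain_lower_bound_add (k l : nat) (c : R) :
  (forall x, c * pi x <= mu k x) -> forall x, c * pi x <= mu (l + k)%N x.
Proof.
move=> le_mu x; rewrite muD -subr_ge0.
rewrite -[X in c * X x](iter_push_invariant l pi_inv) -iter_pushB.
by apply: iter_push_ge0 => // y; rewrite subr_ge0.
Qed.

(** Start from the share 0 at time 0 and advance by blocks of [N] steps; the [k %% N] remaining
    steps lose nothing. *)
Lemma chain_lower_bound (k : nat) (x : I) :
  (1 - (1 - delta) ^+ (k %/ N)) * pi x <= mu k x.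
Proof.
rewrite [k in mu k](divn_eq k N) addnC; move: x.
apply: chain_lower_bound_add.
elim: (k %/ N)%N => [|t IHt] x; first by rewrite expr0 subrr mul0r.
rewrite mulSn; apply: le_trans (chain_lower_bound_step IHt x).
by rewrite exprSr subKr.
Qed.

Lemma chain_dist (k : nat) (B : pred I) :
  `|\sum_(x | B x) pi x - \sum_(x | B x) mu k x| <= (1 - delta) ^+ (k %/ N).
Proof.
set e := _ ^+ _.
have e_ge0 : 0 <= e by rewrite exprn_ge0 ?subr_ge0.
have part (Q : pred I) : \sum_(x | Q x) pi x - \sum_(x | Q x) mu k x <= e.
  rewrite -sumrB (@le_trans _ _ (\sum_(x | Q x) e * pi x)) //.
    apply: ler_sum => x _; have := chain_lower_bound k x; rewrite -/e.
    by rewrite mulrBl mul1r lerBlDr lerBlDr addrC.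
  rewrite -mulr_sumr ler_piMr // -pi_sum [leRHS](bigID Q) /= lerDl.
  exact: sumr_ge0.
(* Both measures have mass 1, so the other side is [part] for the complement of [B]. *)
rewrite ler_norml part andbT lerNl opprB.
have := part (predC B).
have := mu_sum k; have := pi_sum; rewrite !(bigID B predT) /= => pi1 mu1.
apply: le_trans; rewrite -(lerD2r (\sum_(x | B x) pi x)) subrK addrAC.
by rewrite [_ + \sum_(x | B x) pi x]addrC pi1 -mu1 addrK.
Qed.

Lemma chain_cvg (B : pred I) :
  \sum_(x | B x) mu k x @[k --> \oo] --> \sum_(x | B x) pi x.
Proof.
have: `|1 - delta| < 1 by rewrite ger0_norm ?subr_ge0 // gtrBl.
move=> /cvg_expr/cvgrPdist_lt cvg0; apply/cvgrPdist_lt => e e_gt0.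
have [M _ leM] := cvg0 e e_gt0; exists (M * N)%N => // k /= MNk.
apply: le_lt_trans (chain_dist k B) _.
have := leM (k %/ N)%N; rewrite /= leq_divRL // => /(_ MNk).
by rewrite sub0r normrN ger0_norm // exprn_ge0 ?subr_ge0.
Qed.

End FiniteChain.

(** * From the random process to a Markov chain on profiles *)

Lemma probability_partition (R : realType) (d : measure_display)
    (Omega : measurableType d) (Pr : probability Omega R) (I : finType)
    (g : Omega -> I) (E : set Omega) :
  measurable E -> (forall i, measurable [set w | g w = i]) ->
  fine (Pr E) = \sum_i fine (Pr (E `&` [set w | g w = i])).
Proof.
move=> mE mg; rewrite sum_fine => [|i _]; last first.
  by apply: fin_num_measure; apply: measurableI.
congr fine; rewrite fsbig_seq ?index_enum_uniq // -measure_fin_bigcup //=.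
- congr (Pr _); rewrite -setI_bigcupr [X in _ `&` X](_ : _ = setT) ?setIT //.
  by apply/seteqP; split=> // w _; exists (g w); rewrite //= mem_index_enum.
- by apply/trivIsetP => i j _ _ /eqP ij; apply/seteqP;
    split=> // w /= [[_ ->] [_ /ij]].
- by move=> i _; apply: measurableI.
Qed.

Section LawOfLogLinearLearning.
Variables (R : realType) (xbar ybar T n m : nat).
Variables (tau : 'I_m -> task R xbar ybar n).
Variable (A : 'I_n -> {set trajectory xbar ybar T}).

(** Summing over all pairs of a robot and an action accounts for [x = y], which every robot can
    produce by drawing its current action again. *)
Definition lll_kernel (eps : R) (x y : profile xbar ybar T n) : R :=
  n%:R^-1 *
  \sum_j \sum_(a in A j | update x j a == y) lll_prob tau A eps j x a.

Lemma update_inj (x : profile xbar ybar T n) (j : 'I_n) :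
  injective (update x j).
Proof. by move=> a b /ffunP/(_ j); rewrite !ffunE eqxx. Qed.

Lemma lll_prob_gt0 (eps : R) (j : 'I_n) x a :
  a \in A j -> 0 < lll_prob tau A eps j x a.
Proof.
move=> aA; rewrite /lll_prob divr_gt0 ?expR_gt0 // (bigD1 a aA) /=.
by rewrite ltr_pwDl ?expR_gt0 // sumr_ge0 // => b _; rewrite expR_ge0.
Qed.

Lemma lll_prob_sum (eps : R) (j : 'I_n) x :
  A j != finset.set0 -> \sum_(a in A j) lll_prob tau A eps j x a = 1.
Proof.
case/set0Pn => b bA; rewrite /lll_prob -mulr_suml divff // gt_eqF //.
rewrite (bigD1 b bA) /= ltr_pwDl ?expR_gt0 //.
by rewrite sumr_ge0 // => c _; rewrite expR_ge0.
Qed.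

Lemma lll_kernel_ge0 (eps : R) x y : 0 <= lll_kernel eps x y.
Proof.
rewrite mulr_ge0 ?invr_ge0 ?ler0n // sumr_ge0 // => j _.
by apply: sumr_ge0 => a /andP[aA _]; apply/ltW/lll_prob_gt0.
Qed.

Lemma lll_kernel_sum (eps : R) x :
  (0 < n)%N -> (forall j, A j != finset.set0) ->
  \sum_y lll_kernel eps x y = 1.
Proof.
move=> n_gt0 A_neq0; rewrite -mulr_sumr exchange_big /=.
rewrite (eq_bigr (fun=> 1)) => [|j _].
  by rewrite sumr_const card_ord mulVf // pnatr_eq0 -lt0n.
rewrite -(lll_prob_sum eps x (A_neq0 j)).
by rewrite [RHS](partition_big (update x j) predT).
Qed.

Variables (d : measure_display) (Omega : measurableType d).
Variable (Pr : probability Omega R).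
Variables (X : nat -> Omega -> profile xbar ybar T n).
Variables (r : nat -> Omega -> 'I_n).

Definition law (k : nat) (x : profile xbar ybar T n) : R :=
  fine (Pr [set w | X k w = x]).

(** The past as a value in a finite type, so that conditioning on it becomes a finite sum. *)
Definition history (k : nat) (w : Omega) :
    {ffun 'I_k.+1 -> profile xbar ybar T n} * {ffun 'I_k -> 'I_n} :=
  ([ffun l : 'I_k.+1 => X l w], [ffun l : 'I_k => r l w]).

(* The junk robot [j] is only there to extend the picks to all times. *)
Lemma history_fiber (k : nat) (j : 'I_n)
    (h : {ffun 'I_k.+1 -> profile xbar ybar T n} * {ffun 'I_k -> 'I_n}) :
  [set w | history k w = h] =
  past X r k (fun l => h.1 (inord l)) (fun l => oapp h.2 j (insub l)).
Proof.
case: h => x i; apply/seteqP; split=> w /=.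
  case=> <- <-; split=> l lk /=; first by rewrite ffunE inordK.
  by rewrite insubT /= ffunE.
case=> xE iE; congr (_, _); apply/ffunP => l; rewrite ffunE.
  by rewrite xE ?inord_val // -ltnS ltn_ord.
by rewrite iE // valK.
Qed.

Lemma measurable_past (eps : R) p0 (k : nat) x i :
  log_linear_learning tau A Pr X r eps p0 -> measurable (past X r k x i).
Proof.
move=> lll; rewrite (_ : past _ _ _ _ _ =
    (\bigcap_(l in `I_k.+1) [set w | X l w = x l]) `&`
    (\bigcap_(l in `I_k) [set w | r l w = i l])).
  apply: measurableI; apply: fin_bigcap_measurable => // l _.
    exact: (measurable_profile lll).
  exact: (measurable_pick lll).
by apply/seteqP; split=> w.
Qed.

(** Split over the histories up to time [k] and apply [uniform_pick] and [revision] to each. When no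
    action in [A j] leads from [x] to [y], the right side is only known to be nonnegative here,
    whence an inequality. *)
Lemma revision_lower_bound (eps : R) p0 (k : nat) x j y :
  log_linear_learning tau A Pr X r eps p0 ->
  law k x * (n%:R^-1 *
    \sum_(a in A j | update x j a == y) lll_prob tau A eps j x a) <=
  fine (Pr ([set w | X k.+1 w = y] `&` [set w | X k w = x] `&`
            [set w | r k w = j])).
Proof.
move=> lll.
have mX l z : measurable [set w | X l w = z] := measurable_profile lll l z.
have mr l z : measurable [set w | r l w = z] := measurable_pick lll l z.
have mh h : measurable [set w | history k w = h].
  by rewrite (history_fiber j); apply: measurable_past lll.
rewrite /law (probability_partition Pr (mX k x) mh).
rewrite (probability_partition Pr (g := history k)) //; last first.
  by apply: measurableI => //; apply: measurableI.
rewrite mulr_suml; apply: ler_sum => h _.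
have [xh|xh] := eqVneq (h.1 ord_max) x; last first.
  rewrite [X in Pr X](_ : _ = set0) ?measure0 ?mul0r ?fine_ge0 //.
  apply/seteqP; split=> // w /= [Xw hw]; move: xh.
  by rewrite -hw ffunE Xw eqxx.
set xs := fun l => h.1 (inord l) : profile xbar ybar T n.
set rs := fun l => oapp h.2 j (insub l).
have xsk : xs k = x by rewrite -xh /xs; congr (h.1 _); apply: val_inj;
  rewrite /= inordK.
have hE := history_fiber j h; rewrite -/xs -/rs in hE.
have mP := measurable_past k xs rs lll.
have -> : [set w | X k w = x] `&` [set w | history k w = h] = past X r k xs rs.
  rewrite hE; apply/seteqP; split=> w /= [] // Xw rw; split=> //.
  by rewrite Xw.
have [[a /andP[aA /eqP ya]]|noa] := pselect (exists a, (a \in A j) &&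
    (update x j a == y)); last first.
  rewrite big_pred0 ?mulr0 ?fine_ge0 // => a.
  by apply/negP => aA; apply: noa; exists a.
(* Only one action of robot [j] leads from [x] to [y]. *)
rewrite (big_pred1 a) => [|b /=]; last first.
  rewrite -ya (inj_eq (@update_inj x j)); apply: andb_idl => /eqP ->; exact: aA.
have := revision lll k xs rs aA; rewrite (uniform_pick lll) xsk ya => revE.
rewrite (_ : _ `&` _ `&` _ `&` _ =
    past X r k xs rs `&` [set w | r k w = j] `&` [set w | X k.+1 w = y]).
  by rewrite revE !fineM ?fin_numM ?fin_num_measure //= mulrA.
rewrite hE; apply/seteqP; split=> w /=; first by move=> [[[Xy Xx] rw] pw].
move=> [[pw rw] Xy]; do 3!split=> //=.
by case: pw => /(_ k (leqnn k)) ->.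
Qed.

Lemma law_ge0 (k : nat) x : 0 <= law k x.
Proof. exact: fine_ge0. Qed.

Lemma law_partition (eps : R) p0 (k : nat) (B : pred (profile xbar ybar T n)) :
  log_linear_learning tau A Pr X r eps p0 ->
  fine (Pr [set w | B (X k w)]) = \sum_(x | B x) law k x.
Proof.
move=> lll.
have mX z : measurable [set w | X k w = z] := measurable_profile lll k z.
have mB : measurable [set w | B (X k w)].
  rewrite (_ : [set w | _] = \bigcup_(x in [set x | B x]) [set w | X k w = x]).
    by apply: fin_bigcup_measurable => //; exact: finite_finset.
  apply/seteqP; split=> w /=; first by exists (X k w).
  by case=> x /= Bx ->.
rewrite (probability_partition Pr mB mX) [RHS]big_mkcond /=.
apply: eq_bigr => x _; case: ifPn => Bx.
  by congr (fine (Pr _)); apply/seteqP; split=> w /=; [case|move=> ->].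
rewrite [X in Pr X](_ : _ = set0) ?measure0 //.
by apply/seteqP; split=> // w /= [Bw Xw]; move: Bx; rewrite -Xw Bw.
Qed.

Lemma law_sum (eps : R) p0 (k : nat) :
  log_linear_learning tau A Pr X r eps p0 -> \sum_x law k x = 1.
Proof.
move=> lll; rewrite -(law_partition k predT lll).
by rewrite (_ : [set w | _] = setT) ?probability_setT //; apply/seteqP.
Qed.

(** The pushed law is a pointwise lower bound for the next law, and both have total mass 1, so they
    coincide. *)
Lemma law_step (eps : R) p0 (k : nat) :
  (0 < n)%N -> (forall j, A j != finset.set0) ->
  log_linear_learning tau A Pr X r eps p0 ->
  law k.+1 = push (lll_kernel eps) (law k).
Proof.
move=> n_gt0 A_neq0 lll.
have le_law y : push (lll_kernel eps) (law k) y <= law k.+1 y.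
  have mX l z : measurable [set w | X l w = z] := measurable_profile lll l z.
  rewrite /push {2}/law (probability_partition Pr (mX _ _) (mX k)).
  apply: ler_sum => x _; rewrite /lll_kernel !mulr_sumr.
  rewrite (probability_partition Pr (g := r k)) => [||j].
  - by apply: ler_sum => j _; apply: revision_lower_bound lll.
  - exact: measurableI.
  - exact: (measurable_pick lll).
apply/funext => y; apply/eqP; rewrite -subr_eq0; apply/eqP.
apply: (@psumr_eq0P R _ predT (fun y => law k.+1 y - push _ (law k) y)) => //.
  by move=> z _; rewrite subr_ge0.
rewrite sumrB (law_sum _ lll) /push exchange_big /=.
under eq_bigr => x _ do rewrite -mulr_sumr lll_kernel_sum // mulr1.
by rewrite (law_sum _ lll) subrr.
Qed.

End LawOfLogLinearLearning.

(** * The Gibbs measure: invariance, minorization and concentration *)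

Section GibbsMeasure.
Variables (R : realType) (xbar ybar T n m : nat).
Variables (tau : 'I_m -> task R xbar ybar n).
Variables (A : 'I_n -> {set trajectory xbar ybar T}) (eps : R).
Hypotheses (n_gt0 : (0 < n)%N) (A_neq0 : forall j, A j != finset.set0).

Local Notation profile := (profile xbar ybar T n).

Definition action_profile (x : profile) : bool := [forall j, x j \in A j].

(** The kernel acts on all profiles; weight 0 outside the action sets confines the measure to
    them. *)
Definition gibbs_weight (x : profile) : R :=
  if action_profile x then expR (total_value tau x / eps) else 0.

Definition gibbs (x : profile) : R :=
  (\sum_y gibbs_weight y)^-1 * gibbs_weight x.

Lemma counts_update (j : 'I_n) (x : profile) a (l : 'I_m) :
  counts tau (predC1 j) (update x j a) l = counts tau (predC1 j) x l.
Proof.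
apply/ffunP => s; rewrite !ffunE; apply: val_inj => /=.
apply: eq_card => k; rewrite !inE; case: eqP => //= kj.
by rewrite ffunE; case: eqP.
Qed.

Lemma lll_prob_total_value (j : 'I_n) (x : profile) a :
  lll_prob tau A eps j x a = expR (total_value tau (update x j a) / eps) /
    \sum_(b in A j) expR (total_value tau (update x j b) / eps).
Proof.
(* The value obtained without robot [j] does not depend on its action, so it gives a common factor
   [g] that cancels in the quotient. *)
pose g := expR (- ((\sum_l value (counts tau (predC1 j) x l)) / eps)).
have utilE b : expR (utility tau j (update x j b) / eps) =
    expR (total_value tau (update x j b) / eps) * g.
  rewrite -[RHS]expRD; congr expR; rewrite -[RHS]mulrBl; congr (_ / _).
  rewrite /utility sumrB; congr (_ - _).
  by apply: eq_bigr => l _; rewrite counts_update.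
rewrite /lll_prob utilE; under eq_bigr do rewrite utilE.
by rewrite -mulr_suml -mulf_div divff ?mulr1 // gt_eqF // expR_gt0.
Qed.

Lemma update_update (x : profile) (j : 'I_n) a b :
  update (update x j a) j b = update x j b.
Proof. by apply/ffunP => k; rewrite !ffunE; case: eqP. Qed.

Lemma update_id (x : profile) (j : 'I_n) : update x j (x j) = x.
Proof. by apply/ffunP => k; rewrite ffunE; case: eqP => // ->. Qed.

Lemma update_at (x : profile) (j : 'I_n) a : update x j a j = a.
Proof. by rewrite ffunE eqxx. Qed.

(** This form shows the symmetry behind detailed balance: the product of exponentials is symmetric
    in [x] and [y], and the normalizer ignores the action of [j], the only place where the two may
    differ. *)
Lemma gibbs_weight_move (j : 'I_n) (x y : profile) :
  gibbs_weight x *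
    \sum_(a in A j | update x j a == y) lll_prob tau A eps j x a =
  if [&& action_profile x, action_profile y & update x j (y j) == y] then
    expR (total_value tau x / eps) * expR (total_value tau y / eps) /
      \sum_(b in A j) expR (total_value tau (update x j b) / eps)
  else 0.
Proof.
rewrite /gibbs_weight; case: (boolP (action_profile x)) => [xA|_]; last first.
  by rewrite mul0r.
have [xy|xy] := eqVneq (update x j (y j)) y; rewrite ?andbT ?andbF /=;
    last first.
  rewrite big_pred0 ?mulr0 // => a; apply/andP => -[_ /eqP ya].
  by move: xy; rewrite -ya update_at eqxx.
case: (boolP (action_profile y)) => yA.
  rewrite (big_pred1 (y j)) => [|a /=].
    by rewrite lll_prob_total_value xy mulrA.
  rewrite -[in _ == y]xy (inj_eq (@update_inj _ _ _ _ x j)); apply: andb_idl.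
  by move=> /eqP ->; apply: (forallP yA).
rewrite big_pred0 ?mulr0 // => a; apply/andP => -[aA /eqP ya].
case/negP: yA; apply/forallP => k; rewrite -ya ffunE; case: eqP => [->//|_].
exact: (forallP xA).
Qed.

Lemma detailed_balance (x y : profile) :
  gibbs_weight x * lll_kernel tau A eps x y =
  gibbs_weight y * lll_kernel tau A eps y x.
Proof.
rewrite /lll_kernel [LHS]mulrCA [RHS]mulrCA; apply: (congr1 ( *%R _)).
rewrite [LHS]mulr_sumr [RHS]mulr_sumr; apply: eq_bigr => j _.
rewrite !gibbs_weight_move.
have [xy|xy] := eqVneq (update x j (y j)) y.
  have -> : update y j (x j) = x.
    by rewrite -[in update y]xy update_update update_id.
  have -> : \sum_(b in A j) expR (total_value tau (update x j b) / eps) =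
            \sum_(b in A j) expR (total_value tau (update y j b) / eps).
    by apply: eq_bigr => b _; rewrite -[in RHS]xy update_update.
  by rewrite eqxx !andbT andbC [X in X / _]mulrC.
have [yx|] := eqVneq (update y j (x j)) x; last by rewrite !andbF.
by case/eqP: xy; rewrite -[in LHS]yx update_update update_id.
Qed.

Lemma gibbs_invariant : push (lll_kernel tau A eps) gibbs = gibbs.
Proof.
apply/funext => y; rewrite /push /gibbs.
under eq_bigr do rewrite -mulrA detailed_balance.
by rewrite -mulr_sumr -mulr_sumr lll_kernel_sum // mulr1.
Qed.

Lemma gibbs_weight_ge0 (x : profile) : 0 <= gibbs_weight x.
Proof. by rewrite /gibbs_weight; case: ifP => // _; rewrite expR_ge0. Qed.

Lemma exists_action_profile : exists x : profile, action_profile x.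
Proof.
have ex j : exists a, a \in A j by apply/set0Pn.
exists [ffun j => xchoose (ex j)]; apply/forallP => j.
by rewrite ffunE; exact: xchooseP (ex j).
Qed.

Lemma partition_function_gt0 : 0 < \sum_x gibbs_weight x.
Proof.
have [x xA] := exists_action_profile.
rewrite (bigD1 x) //= ltr_pwDl ?sumr_ge0 // => [|y _]; last first.
  exact: gibbs_weight_ge0.
by rewrite /gibbs_weight xA expR_gt0.
Qed.

Lemma gibbs_ge0 (x : profile) : 0 <= gibbs x.
Proof.
by rewrite mulr_ge0 ?gibbs_weight_ge0 // invr_ge0 ltW // partition_function_gt0.
Qed.

Lemma gibbs_sum : \sum_x gibbs x = 1.
Proof. by rewrite -mulr_sumr mulVf // gt_eqF // partition_function_gt0. Qed.

Lemma lll_kernel_update_gt0 (x : profile) (j : 'I_n) a :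
  a \in A j -> 0 < lll_kernel tau A eps x (update x j a).
Proof.
move=> aA; rewrite mulr_gt0 ?invr_gt0 ?ltr0n // (bigD1 j) //=.
rewrite ltr_pwDl ?sumr_ge0 // => [|k _]; last first.
  by apply: sumr_ge0 => b /andP[bA _]; apply/ltW/lll_prob_gt0.
rewrite (bigD1 a) /=; last by rewrite aA eqxx.
rewrite ltr_pwDl ?lll_prob_gt0 // sumr_ge0 // => b /andP[/andP[bA _] _].
exact/ltW/lll_prob_gt0.
Qed.

Lemma lll_kernel_update_lower_bound : exists eta : R,
  [/\ 0 < eta, eta <= 1 & forall (x : profile) (j : 'I_n) a, a \in A j ->
        eta <= lll_kernel tau A eps x (update x j a)].
Proof.
pose F (u : profile * 'I_n * trajectory xbar ybar T) :=
  lll_kernel tau A eps u.1.1 (update u.1.1 u.1.2 u.2).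
(* A minimum of finitely many positive numbers; the base value 1 provides [eta <= 1]. *)
exists (\big[Order.min/1]_(u | u.2 \in A u.1.2) F u); split.
- by apply/bigmin_gtP; split=> // u uA; apply: lll_kernel_update_gt0.
- exact: bigmin_le_id.
- by move=> x j a aA; apply: (bigmin_le_cond _ (j := (x, j, a))).
Qed.

(* Only the paths that revise robots 0, ..., l-1 in turn, each to its action in
   [z], are counted. *)
Lemma push_sequential_revision (eta : R) (nu : profile -> R) (z : profile)
    (l : nat) :
  0 <= eta -> (forall x, 0 <= nu x) -> action_profile z ->
  (forall x j a, a \in A j -> eta <= lll_kernel tau A eps x (update x j a)) ->
  (l <= n)%N ->
  eta ^+ l * \sum_x nu x <=
  \sum_(y : profile | [forall i : 'I_n, (i < l)%N ==> (y i == z i)])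
    iter l (push (lll_kernel tau A eps)) nu y.
Proof.
move=> eta_ge0 nu_ge0 zA le_eta; elim: l => [_|l IHl ln].
  rewrite expr0 mul1r le_eqVlt; apply/orP; left; apply/eqP/eq_bigl => y.
  by apply/esym/forallP.
have K_ge0 x y : 0 <= lll_kernel tau A eps x y := lll_kernel_ge0 tau A eps x y.
have nul_ge0 := iter_push_ge0 (K := lll_kernel tau A eps) l K_ge0 nu_ge0.
rewrite iterS; set nul := iter l _ nu in IHl nul_ge0 *.
rewrite exprS -mulrA; apply: (le_trans (ler_wpM2l eta_ge0 (IHl (ltnW ln)))).
rewrite /push exchange_big /= mulr_sumr.
(* Keep only the predecessors that agree with [z] on the robots below [l], and from each only the
   move that revises robot [l] to its action in [z]. *)
rewrite [leRHS](bigID [pred x : profile |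
  [forall i : 'I_n, (i < l)%N ==> (x i == z i)]]) /=.
apply: ler_wpDr.
  by apply: sumr_ge0 => x _; apply: sumr_ge0 => y _; apply: mulr_ge0.
apply: ler_sum => x xz; set j := Ordinal ln.
have ujz : [forall i : 'I_n, (i < l.+1)%N ==> (update x j (z j) i == z i)].
  apply/forallP => i; apply/implyP; rewrite ltnS ffunE => il.
  have [->//|ij] := eqVneq i j; move/forallP/(_ i)/implyP: xz; apply.
  by rewrite ltn_neqAle il andbT; apply: contra_neq ij => ?; apply: val_inj.
rewrite (bigD1 (update x j (z j))) //= ler_wpDr //.
  by apply: sumr_ge0 => y _; apply: mulr_ge0.
by rewrite mulrC ler_wpM2l // le_eta // (forallP zA).
Qed.

(** After all [n] robots have been revised, the only profile left in the sum is [z]. This bounds its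
    mass below by [eta ^+ n] times the initial mass, and [gibbs z <= 1] yields Doeblin's form. *)
Lemma lll_minorization : exists delta : R,
  [/\ 0 < delta, delta <= 1 & forall nu : profile -> R, (forall x, 0 <= nu x) ->
    forall z, delta * (\sum_x nu x) * gibbs z <=
      iter n (push (lll_kernel tau A eps)) nu z].
Proof.
have [eta [eta_gt0 eta_le1 le_eta]] := lll_kernel_update_lower_bound.
exists (eta ^+ n); split=> [||nu nu_ge0 z].
- exact: exprn_gt0.
- by rewrite exprn_ile1 // ltW.
have [zA|zA] := boolP (action_profile z); last first.
  rewrite /gibbs /gibbs_weight (negPf zA) !mulr0; apply: iter_push_ge0 => //.
  exact: lll_kernel_ge0.
have := push_sequential_revision (ltW eta_gt0) nu_ge0 zA le_eta (leqnn n).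
rewrite [X in _ <= X -> _](big_pred1 z) => [|y /=]; last first.
  apply/idP/eqP => [/forallP yz|->]; last first.
    by apply/forallP => i; rewrite eqxx implybT.
  by apply/ffunP => i; apply/eqP; have := yz i; rewrite ltn_ord.
apply: le_trans; apply: ler_piMr.
  by rewrite mulr_ge0 ?sumr_ge0 // exprn_ge0 // ltW.
rewrite -gibbs_sum (bigD1 z) //= lerDl; apply: sumr_ge0 => y _.
exact: gibbs_ge0.
Qed.

Lemma lll_cvg_gibbs (d : measure_display) (Omega : measurableType d)
    (Pr : probability Omega R) (X : nat -> Omega -> profile)
    (r : nat -> Omega -> 'I_n) (p0 : profile) (B : pred profile) :
  log_linear_learning tau A Pr X r eps p0 ->
  fine (Pr [set w | B (X k w)]) @[k --> \oo] --> \sum_(x | B x) gibbs x.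
Proof.
move=> lll; have [delta [delta_gt0 delta_le1 minor]] := lll_minorization.
under eq_fun do rewrite (law_partition _ _ lll).
apply: (chain_cvg (K := lll_kernel tau A eps) (delta := delta) (N := n)) => //.
- exact: lll_kernel_ge0.
- exact: gibbs_invariant.
- exact: gibbs_ge0.
- exact: gibbs_sum.
- by move=> x; apply: law_ge0.
- by move=> k; apply: law_sum lll.
- by move=> k; apply: law_step lll.
Qed.

Lemma gibbs_concentration (M : R) : 0 < eps ->
  (exists2 x, action_profile x & total_value tau x = M) ->
  (forall x, action_profile x -> total_value tau x <= M) ->
  1 - eps * \sum_(x : profile | total_value tau x < M)
              (M - total_value tau x)^-1 <=
  \sum_(x | total_value tau x == M) gibbs x <= 1.
Proof.
move=> eps_gt0 [x0 x0A x0M] le_M.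
have gibbs_small x : total_value tau x < M ->
    gibbs x <= eps * (M - total_value tau x)^-1.
  move=> xM; rewrite -subr_gt0 in xM; rewrite /gibbs /gibbs_weight.
  case: ifP => _; last by rewrite mulr0 mulr_ge0 ?invr_ge0 // ltW.
  set u := (M - total_value tau x) / eps.
  have u_gt0 : 0 < u by rewrite divr_gt0.
  have -> : eps * (M - total_value tau x)^-1 = u^-1 by rewrite invf_div.
  have -> : total_value tau x / eps = M / eps - u by rewrite /u -mulrBl subKr.
  have Z_gt0 := partition_function_gt0.
  rewrite expRB mulrA -[leRHS]mul1r.
  apply: ler_pM;
    rewrite ?invr_ge0 ?mulr_ge0 ?invr_ge0 ?expR_ge0 ?(ltW Z_gt0) //.
    (* The term of the maximizer [x0] alone bounds the partition function below by exp(M / eps). *)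
    rewrite mulrC ler_pdivrMr // mul1r (bigD1 x0) //= x0A x0M.
    by rewrite lerDl sumr_ge0 // => y _; apply: gibbs_weight_ge0.
  (* exp(-u) <= 1 / u, since u <= 1 + u <= exp(u). *)
  rewrite lef_pV2 ?posrE ?expR_gt0 //.
  by apply: le_trans (expR_ge1Dx u); apply: ler_wpDl.
apply/andP; split; last first.
  rewrite -gibbs_sum [leRHS](bigID (fun x => total_value tau x == M)) /=.
  by rewrite lerDl sumr_ge0 // => x _; apply: gibbs_ge0.
rewrite lerBlDr -[leLHS]gibbs_sum.
rewrite [leLHS](bigID (fun x => total_value tau x == M)) /= lerD2l mulr_sumr.
rewrite [leLHS](bigID (fun x => total_value tau x < M)) /=.
(* A profile of value above [M] is not an action profile, so its Gibbs mass is 0. *)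
rewrite [X in _ + X]big1 ?addr0 => [|x /andP[xM /negP xltM]]; last first.
  rewrite /gibbs /gibbs_weight; case: ifP => [/le_M|_]; last by rewrite mulr0.
  by rewrite le_eqVlt (negPf xM) => /xltM.
rewrite (eq_bigl (fun x => total_value tau x < M)) => [|x]; last first.
  by rewrite andb_idl // => /lt_eqF ->.
exact: ler_sum.
Qed.
End GibbsMeasure.

(** * Covering action sets contain an optimum over all feasible profiles *)

Section Optimum.
Variables (R : realType) (xbar ybar T n m : nat) (PF : {set cell xbar ybar}).
Variables (sigma : 'I_n -> cell xbar ybar) (tau : 'I_m -> task R xbar ybar n).
Variable (A : 'I_n -> {set trajectory xbar ybar T}).
Hypotheses (tau_valid : forall j, valid_task T PF (tau j))
  (A_covering : forall i, covering PF tau (sigma i) (A i)).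

Local Notation profile := (profile xbar ybar T n).

(** If [q] counts a robot for a task at time [t], then [t] is a task time of that robot, so [p]
    counts it there too. *)
Lemma total_value_dominated (p q : profile) :
  (forall i (t : 'I_T), t \in task_times tau (q i) ->
     stays_at (p i) t (q i (inord t))) ->
  total_value tau q <= total_value tau p.
Proof.
move=> p_stays; apply: ler_sum => j _; apply: (value_monotone (tau_valid j)).
move=> s; rewrite !ffunE /=; apply: subset_leq_card; apply/fintype.subsetP => k.
rewrite !inE /= => qk; have lt_s : (arrival (tau j) + s < departure (tau j))%N.
  by rewrite -ltn_subRL.
have ltT := leq_trans lt_s (departure_le (tau_valid j)).
have := p_stays k (Ordinal ltT); rewrite /= (eqP (andP qk).1); apply.
by rewrite inE; apply/existsP; exists j; rewrite /= qk lt_s leq_addr.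
Qed.

Lemma covering_dominates (q : profile) :
  q \in feasible_profiles T PF sigma ->
  exists2 p : profile, action_profile A p &
    total_value tau q <= total_value tau p.
Proof.
rewrite inE => /forallP q_feas.
have ex i : exists a, (a \in A i) && [forall t : 'I_T,
    (t \in task_times tau (q i)) ==> stays_at a t (q i (inord t))].
  (* Covering speaks only of trajectories outside [A i]; one inside covers itself, as it stays put
     at its task times. *)
  have [qA|qA] := boolP (q i \in A i).
    exists (q i); rewrite qA; apply/forallP => t; apply/implyP; rewrite inE.
    by move=> /existsP[j /andP[/andP[/eqP qt /eqP qt1] _]];
      rewrite /stays_at qt qt1 eqxx.
  have [_ _ /(_ _ (q_feas i) qA)[a aA stays]] := A_covering i.
  by exists a; rewrite aA; apply/forallP => t; apply/implyP; apply: stays.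
exists [ffun i => xchoose (ex i)].
  by apply/forallP => i; rewrite ffunE; have /andP[] := xchooseP (ex i).
apply: total_value_dominated => i t tq; rewrite ffunE.
by have /andP[_ /forallP/(_ t)/implyP] := xchooseP (ex i); apply.
Qed.

Lemma action_profile_feasible (p : profile) :
  action_profile A p -> p \in feasible_profiles T PF sigma.
Proof.
move=> /forallP pA; rewrite inE; apply/forallP => i.
by have [_ /fintype.subsetP/(_ _ (pA i))] := A_covering i.
Qed.

Lemma le_max_total_value (p : profile) :
  action_profile A p -> total_value tau p <= max_total_value T PF sigma tau.
Proof. by move=> pA; apply: le_bigmax_cond; apply: action_profile_feasible. Qed.

Lemma max_total_value_attained : exists2 p : profile,
  action_profile A p & total_value tau p = max_total_value T PF sigma tau.
Proof.
have A_neq0 j : A j != finset.set0 by have [] := A_covering j.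
have [p0 p0A] := exists_action_profile A_neq0.
(* Nonnegativity ensures that the maximum is attained by a profile rather than by the base value
   0. *)
have tv_ge0 q : q \in feasible_profiles T PF sigma -> 0 <= total_value tau q.
  by move=> _; apply: sumr_ge0 => j _; apply: value_ge0 (tau_valid j) _.
have [q q_feas max_q] := eq_bigmax p0 (mem (feasible_profiles T PF sigma)) _
  (action_profile_feasible p0A) tv_ge0.
have [p pA qp] := covering_dominates q_feas.
exists p => //; apply: le_anti; rewrite le_max_total_value //=.
by rewrite /max_total_value max_q.
Qed.

End Optimum.

(** * The limit in time, then the limit in the noise *)

Theorem theorem2 (R : realType) (xbar ybar T n m : nat)
    (PF S : {set cell xbar ybar}) (sigma : 'I_n -> cell xbar ybar)
    (tau : 'I_m -> task R xbar ybar n)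
    (n_gt0 : (0 < n)%N)
    (S_feasible : S \subset PF)
    (sigma_station : forall i, sigma i \in S)
    (tau_valid : forall j, valid_task T PF (tau j))
    (tau_non_overlapping : non_overlapping tau)
    (A : 'I_n -> {set trajectory xbar ybar T})
    (A_minimal : forall i, minimal_action_set PF tau (sigma i) (A i))
    (d : R -> measure_display)
    (Omega : forall eps : R, measurableType (d eps))
    (Pr : forall eps : R, probability (Omega eps) R)
    (X : forall eps : R, nat -> Omega eps -> profile xbar ybar T n)
    (r : forall eps : R, nat -> Omega eps -> 'I_n)
    (p0 : R -> profile xbar ybar T n)
    (p0_in_A : forall eps : R, 0 < eps -> forall i, p0 eps i \in A i)
    (X_lll : forall eps : R, 0 < eps ->
       log_linear_learning tau A (Pr eps) (X eps) (r eps) eps (p0 eps)) :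
  let prob_opt (eps : R) (k : nat) : R :=
    fine (Pr eps [set w | total_value tau (X eps k w) =
                          max_total_value T PF sigma tau]) in
  (forall eps : R, 0 < eps -> cvgn (prob_opt eps)) /\
  limn (prob_opt eps) @[eps --> (0 : R)^'+] --> (1 : R).
Proof.
move=> prob_opt.
have A_covering i : covering PF tau (sigma i) (A i) := (A_minimal i).1.
have A_neq0 j : A j != finset.set0 by have [] := A_covering j.
set M := max_total_value T PF sigma tau.
have prob_opt_cvg eps : 0 < eps -> prob_opt eps k @[k --> \oo] -->
    \sum_(x | total_value tau x == M) gibbs tau A eps x.
  move=> eps_gt0; have -> : prob_opt eps =
      fun k => fine (Pr eps [set w | total_value tau (X eps k w) == M]).
    apply/funext => k; congr (fine (Pr eps _)).
    by apply/seteqP; split=> w /= /eqP.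
  exact: (lll_cvg_gibbs n_gt0 A_neq0
    (B := fun x => total_value tau x == M) (X_lll eps eps_gt0)).
split=> [eps eps_gt0|]; first by apply/cvg_ex; eexists; apply: prob_opt_cvg.
(* [C] does not depend on [eps], so the lower bound [1 - eps * C] tends to 1. *)
pose C := \sum_(x : profile xbar ybar T n | total_value tau x < M)
  (M - total_value tau x)^-1.
apply: (squeeze_cvgr (f := fun eps => 1 - eps * C) (h := cst 1)).
- near=> eps; have eps_gt0 : 0 < eps by near: eps; exact: nbhs_right_gt.
  rewrite (cvg_lim _ (prob_opt_cvg eps eps_gt0)) //.
  apply: gibbs_concentration => //.
    exact: max_total_value_attained tau_valid A_covering.
  by move=> x; exact: (le_max_total_value A_covering).
- rewrite -[X in _ --> X](subr0 1) -[X in _ --> _ - X](mul0r C).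
  apply: cvgB; first exact: cvg_cst.
  by apply: cvgMr_tmp; apply: cvg_at_right_filter; exact: cvg_id.
- exact: cvg_cst.
Unshelve. all: by end_near.
Qed.
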